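(* Let $\alpha,\beta,\gamma,\delta>-1$ and let $n\ge1$ be an integer. Then, for every $f\in\Pi_n$, $$\|\Phi_x\,\partial_xf\|_{L^2(\mathrm T,W)}^2\le n(n+\gamma+\delta+1)\,\|f\|_{L^2(\mathrm T,W)}^2,$$ $$\|\Phi_y\,D_yf\|_{L^2(\mathrm T,W)}^2\le n(n+\alpha+\beta+1)\,\|f\|_{L^2(\mathrm T,W)}^2.$$ Both constants are sharp. Equality in the first inequality is attained by $f=\mathbb P_n^n$, and equality in the second inequality is attained by $f=\mathbb P_0^n$.
   Context: $\Pi_n$ is the space of real algebraic polynomials in two variables of total degree at most $n$. The trapezoid is $\mathrm T=\{(x,y)\in\mathbb R^2:0\le y\le 1,\ 0\le x\le 2-y\}$. The weight is $$W(x,y)=x^\gamma(2-x-y)^\delta y^\alpha(1-y)^\beta(2-y)^{-(\gamma+\delta+1)},$$ and $\|u\|_{L^2(\mathrm T,W)}^2=\int_{\mathrm T}|u|^2W\,dx\,dy$. Further, $\Phi_x(x,y)=\sqrt{x(2-x-y)}$, $\Phi_y(x,y)=\sqrt{y(1-y)}$, and $D_yf=\partial_yf-\frac{x}{2-y}\,\partial_xf$. $P_n^{(a,b)}$ denotes the classical Jacobi polynomial of degree $n$, orthogonal on $[-1,1]$ with respect to $(1-u)^a(1+u)^b$, and $\mathsf P_n^{(a,b)}(u)=P_n^{(a,b)}(1-2u)$ is its shifted version on $[0,1]$. For each integer $k\ge0$, $\{\mathsf P_{m,k}^{(\alpha,\beta)}\}_{m\ge0}$ denotes the system of orthonormal polynomials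 ($\deg \mathsf P_{m,k}^{(\alpha,\beta)}=m$) on $[0,1]$ with respect to the weight $(2-y)^{2k}y^\alpha(1-y)^\beta$. For $0\le k\le n$, $$\mathbb P_k^n(x,y)=(2-y)^k\,\mathsf P_k^{(\gamma,\delta)}\!\left(\frac{x}{2-y}\right)\mathsf P_{n-k,k}^{(\alpha,\beta)}(y),$$ which is a polynomial of total degree $n$ in $(x,y)$. *)

(* Defs.v *)
From HB Require Import structures.
From mathcomp Require Import all_boot all_order all_algebra.
From mathcomp Require Import all_classical all_reals all_analysis.
(* The notations of mpoly clash with those of mathcomp-analysis. *)
From mathcomp Require Import -(notations) mpoly.
Set Implicit Arguments.
Unset Strict Implicit.
Unset Printing Implicit Defensive.
Import Order.TTheory GRing.Theory Num.Theory.
Import numFieldNormedType.Exports.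
Local Open Scope classical_set_scope.
Local Open Scope ring_scope.

Section Trapezoid.
Variable R : realType.
Implicit Types (f p : mpoly 2 R) (z : R * R) (u : R * R -> R).

Definition iX : 'I_2 := ord0.
Definition iY : 'I_2 := ord_max.

(* msize is 1 + total degree, and 0 for the zero polynomial. *)
Definition Pi_n (n : nat) : set (mpoly 2 R) := [set f | (msize f <= n.+1)%N].

Definition eval2 f z : R := meval (fun i => if i == iX then z.1 else z.2) f.

Definition dx f z : R := eval2 (mderiv iX f) z.
Definition dy f z : R := eval2 (mderiv iY f) z.
Definition Dy f z : R := dy f z - z.1 / (2 - z.2) * dx f z.

Definition trapezoid : set (R * R) :=
  [set z | 0 <= z.2 <= 1 /\ 0 <= z.1 <= 2 - z.2].

Definition W (alpha beta gamma delta : R) z : R :=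
  z.1 `^ gamma * (2 - z.1 - z.2) `^ delta * z.2 `^ alpha * (1 - z.2) `^ beta
  * (2 - z.2) `^ (- (gamma + delta + 1)).

Definition normsq (alpha beta gamma delta : R) u : \bar R :=
  (\int[lebesgue_measure \x lebesgue_measure]_(z in trapezoid)
     (`|u z| ^+ 2 * W alpha beta gamma delta z)%:E)%E.

Definition Phix z : R := Num.sqrt (z.1 * (2 - z.1 - z.2)).
Definition Phiy z : R := Num.sqrt (z.2 * (1 - z.2)).

(* Szego, Orthogonal Polynomials, (4.21.2): P_n^(a,b)(t) is
   sum_(v <= n) (n+a+b+1)...(n+a+b+v) (a+v+1)...(a+n) / (v! (n-v)!)
                * ((t - 1) / 2)^v,
   the standardization with P_n^(a,b)(1) = (a+1)...(a+n) / n!. *)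
Definition jacobi (n : nat) (a b : R) : {poly R} :=
  \sum_(v < n.+1)
    ((\prod_(1 <= j < v.+1) (n%:R + a + b + j%:R))
     * (\prod_(v.+1 <= j < n.+1) (a + j%:R))
     / (v`!%:R * (n - v)`!%:R))
    *: (2^-1 *: ('X - 1)) ^+ v.

Definition sjacobi (n : nat) (a b : R) : {poly R} :=
  jacobi n a b \Po (1 - 2 *: 'X).

(* P m k is the m-th polynomial for the weight with parameter k. Such a system
   is unique up to the sign of each polynomial. *)
Definition orthonormal_family (alpha beta : R) (P : nat -> nat -> {poly R}) :=
  (forall m k, size (P m k) = m.+1) /\
  (forall k m l,
    \int[lebesgue_measure]_(y in `[0%R, 1%R])
      ((P m k).[y] * (P l k).[y]
       * ((2 - y) ^+ (2 * k) * y `^ alpha * (1 - y) `^ beta))%:E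
    = (m == l)%:R%:E)%E.

Definition mX : mpoly 2 R := mpolyX R (mnm1 iX).
Definition mY : mpoly 2 R := mpolyX R (mnm1 iY).

(* The factor (2 - y)^k p(x / (2 - y)), for p of degree at most k, written as
   the polynomial sum_i p_i x^i (2 - y)^(k - i). *)
Definition homog (k : nat) (p : {poly R}) : mpoly 2 R :=
  \sum_(i < k.+1) p`_i *: (mX ^+ i * (2 - mY) ^+ (k - i)).

Definition bbP (gamma delta : R) (P : nat -> nat -> {poly R}) (n k : nat) :
    mpoly 2 R :=
  homog k (sjacobi k gamma delta) * (map_poly (@mpolyC 2 R) (P (n - k)%N k)).[mY].

Lemma size_sjacobi (n : nat) (a b : R) : (size (sjacobi n a b) <= n.+1)%N.
Proof.
have sXB1 : (size ('X - 1 : {poly R})%R <= 2)%N by rewrite -polyC1 size_XsubC.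
have sj : (size (jacobi n a b) <= n.+1)%N.
  apply: (leq_trans (size_sum _ _ _)); apply/bigmax_leqP => i _.
  apply: (leq_trans (size_scale_leq _ _)).
  apply: (leq_trans (size_poly_exp_leq _ _)).
  rewrite ltnS (leq_trans _ (leq_ord i))// -[leqRHS]mul1n leq_mul2r.
  apply/orP; right; have := leq_trans (size_scale_leq 2^-1 _) sXB1.
  by case: (size _) => [|[|[|]]].
apply: (leq_trans (size_comp_poly_leq _ _)); rewrite ltnS.
have -> : (size (1 - 2 *: 'X : {poly R})%R).-1 = 1%N.
  rewrite addrC size_polyDl ?size_polyN ?size_scale ?size_polyX ?pnatr_eq0//.
  by rewrite size_poly1.
by rewrite muln1; case: (size _) sj.
Qed.

Lemma bbPE (gamma delta : R) (P : nat -> nat -> {poly R}) (n k : nat)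
    (x y : R) : y != 2 ->
  eval2 (bbP gamma delta P n k) (x, y) =
  (2 - y) ^+ k * (sjacobi k gamma delta).[x / (2 - y)] * (P (n - k)%N k).[y].
Proof.
move=> y2; have y20 : 2 - y != 0 by rewrite subr_eq0 eq_sym.
rewrite /eval2 /bbP; set v := fun i => _.
have vX : meval v mX = x by rewrite mevalXU.
have vY : meval v mY = y by rewrite mevalXU.
rewrite mevalM; congr (_ * _).
  rewrite /homog rmorph_sum/= (horner_coef_wide _ (size_sjacobi _ _ _)) mulr_sumr.
  apply: eq_bigr => i _.
  rewrite mevalZ mevalM !rmorphXn/= rmorphB/= vX vY rmorph_nat.
  rewrite [RHS]mulrCA; congr (_ * _).
  by rewrite expr_div_n expfB_cond ?(negPf y20) ?leq_ord// mulrCA.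
rewrite -horner_map/= vY -map_poly_comp/=.
by rewrite (eq_map_poly (g := id)) ?map_poly_id// => c /=; rewrite mevalC.
Qed.

End Trapezoid.

(* Main.v *)
Require Import Defs.
From HB Require Import structures.
From mathcomp Require Import all_boot all_order all_algebra.
From mathcomp Require Import all_classical all_reals all_analysis.
From mathcomp Require Import -(notations) mpoly.
From mathcomp Require Import measurable_realfun ring lra.
Import Order.TTheory GRing.Theory Num.Theory.
Import numFieldNormedType.Exports.
Local Open Scope classical_set_scope.
Local Open Scope ring_scope.
Set Implicit Arguments.
Unset Strict Implicit.
Unset Printing Implicit Defensive.

(** The substitution x = (2 - y) s turns W dx dy on the trapezoid into the
    product w_(gamma,delta)(s) w_(alpha,beta)(y) ds dy of Jacobi weights on the
    unit square, Phi_x d/dx into sqrt(s(1-s)) d/ds, and Phi_y D_y into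
    sqrt(y(1-y)) d/dy.  A polynomial f of total degree at most n becomes a
    polynomial of degree at most n in s for fixed y, and in y for fixed s, so
    both inequalities follow by integrating the univariate Bernstein inequality
    in L^2 with Jacobi weight over fibers.  The univariate inequality comes from
    the Sturm-Liouville operator A p = -(s(1-s)p'' + (a+1-(a+b+2)s)p'): it is
    symmetric with energy the integral of s(1-s)p'q'w, the Jacobi polynomials
    are eigenvectors with increasing eigenvalues n(n+a+b+1), and one expands p
    in them.  The extremal polynomials separate as P(s)Q(y) with a Jacobi
    polynomial in the relevant variable. *)

(** * Integrals over (0, 1) by exhaustion with compact intervals *)

Section Exhaustion.
Variable R : realType.
Local Notation mu := (@lebesgue_measure R).

(** The shift by 3 makes [eps n < 1 - eps n] hold already at n = 0, so every [inner n] is a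
    nondegenerate interval. *)
Let eps (n : nat) : R := n.+3%:R^-1.

Definition inner (n : nat) : set R := `[eps n, 1 - eps n].

Let eps_gt0 n : 0 < eps n. Proof. by rewrite invr_gt0. Qed.

Let eps_lt n : eps n < 1 - eps n.
Proof.
rewrite ltrBrDr -mulr2n -mulr_natl /eps ltr_pdivrMr// mul1r ltr_nat.
by [].
Qed.

Let epsS m n : (m <= n)%N -> eps n <= eps m.
Proof. by move=> mn; rewrite lef_pV2 ?posrE// ler_nat !ltnS. Qed.

Lemma inner_sub m n : (m <= n)%N -> inner m `<=` inner n.
Proof.
move=> /epsS mn x; rewrite /inner/= !in_itv/= => /andP[mx xm].
by rewrite (le_trans mn)//= (le_trans xm)// lerB.
Qed.

Lemma inner_oo n : inner n `<=` `](0 : R), 1[%classic.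
Proof.
move=> x; rewrite /inner/= !in_itv/= => /andP[mx xm].
by rewrite (lt_le_trans _ mx)//= (le_lt_trans xm)// gtrBl.
Qed.

Lemma bigcup_inner : \bigcup_n inner n = `](0 : R), 1[%classic.
Proof.
apply/seteqP; split=> [x [n _ /inner_oo]//|x /=].
rewrite in_itv/= => /andP[x0 x1].
have /ltr_add_invr[k] : 0 < Num.min x (1 - x) by rewrite lt_min x0 subr_gt0.
rewrite add0r lt_min => /andP[kx kx1].
have ek : eps k <= k.+1%:R^-1 by rewrite lef_pV2 ?posrE// ler_nat 2?leqW.
exists k => //=; rewrite /inner/= in_itv/= (le_trans ek (ltW kx))/=.
by rewrite lerBrDr -lerBrDl (le_trans ek (ltW kx1)).
Qed.

Lemma measurable_inner n : measurable (inner n).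
Proof. exact: measurable_itv. Qed.

Section FTC.
Variables f F : R -> R.
Hypothesis cf : {in `](0 : R), 1[, continuous f}.
Hypothesis dF : forall x, x \in `](0 : R), 1[ -> is_derive x 1 F (f x).

Lemma measurable_fun_oo : measurable_fun `](0 : R), 1[%classic f.
Proof.
apply: open_continuous_measurable_fun => //.
by move=> x; rewrite inE => xi; exact: cf.
Qed.

Lemma integral_inner n :
  (\int[mu]_(x in inner n) (f x)%:E = (F (1 - eps n) - F (eps n))%:E)%E.
Proof.
have I : {subset `[eps n, 1 - eps n] <= `]0, 1[}.
  by move=> x xi; apply: inner_oo; exact: xi.
have cF x : x \in `](0 : R), 1[ -> {for x, continuous F}.
  move=> /dF[dx _]; apply: differentiable_continuous.
  exact/derivable1_diffP.
rewrite EFinB; apply: continuous_FTC2 => //.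
- apply: continuous_in_subspaceT => x; rewrite inE => /I; exact: cf.
- have el : eps n \in `]0, 1[ by apply: I; rewrite in_itv/= lexx ltW.
  have er : 1 - eps n \in `]0, 1[ by apply: I; rewrite in_itv/= lexx ltW.
  split.
  + by move=> x /subset_itv_oo_cc/I/dF[].
  + exact/cvg_at_right_filter/cF.
  + exact/cvg_at_left_filter/cF.
- move=> x /subset_itv_oo_cc/I/dF dx; rewrite derive1E; exact: derive_val.
Qed.

(** Monotone convergence along [inner n]: each partial integral is a difference of two values of F,
    hence at most M + M. The integrand itself may blow up at the endpoints. *)
Lemma ge0_integrable_oo (M : R) :
  {in `](0 : R), 1[, forall x, 0 <= f x} -> {in `](0 : R), 1[, forall x, `|F x| <= M} ->
  mu.-integrable `](0 : R), 1[%classic (EFin \o f).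
Proof.
move=> f0 FM; apply/integrableP; split.
  by apply/measurable_EFinP; exact: measurable_fun_oo.
rewrite (_ : integral _ _ _ = \int[mu]_(x in `](0%R : R), 1%R[) (f x)%:E)%E; last first.
  by apply: eq_integral => x; rewrite inE => /f0 fx /=; rewrite ger0_norm.
have := @ge0_nondecreasing_set_cvg_integral _ (measurableTypeR R) R inner (EFin \o f) mu.
rewrite bigcup_inner => h; apply: (@le_lt_trans _ _ (M + M)%:E); last exact: ltry.
apply: (cvge_le _ (h _ _ _ _)).
- apply: nearW => n; rewrite /comp integral_inner lee_fin.
  have h1 : 1 - eps n \in `]0, 1[.
    by rewrite in_itv/= gtrBl eps_gt0 (lt_trans _ (eps_lt n)).
  have h2 : eps n \in `]0, 1[ by rewrite in_itv/= eps_gt0 (lt_trans (eps_lt n))// gtrBl.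
  rewrite (le_trans (ler_norm _))// (le_trans (ler_normB _ _))// lerD//; exact: FM.
- by move=> m n mn; apply/subsetPset/inner_sub.
- exact: measurable_inner.
- move=> n; apply/measurable_EFinP; apply: measurable_funS measurable_fun_oo => //.
  exact: inner_oo.
- by move=> n x /inner_oo /f0; rewrite lee_fin.
Qed.

(** Dominated convergence, with |f| as the dominating function: the integrals over [inner n] are
    boundary differences of F and tend to 0. *)
Lemma integral_oo_eq0 : mu.-integrable `](0 : R), 1[%classic (EFin \o f) ->
  F (eps n) @[n --> \oo] --> 0 -> F (1 - eps n) @[n --> \oo] --> 0 ->
  (\int[mu]_(x in `](0%R : R), 1%R[) (f x)%:E = 0)%E.
Proof.
move=> fi F0 F1.
have mEf : measurable_fun `](0 : R), 1[%classic (EFin \o f).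
  by apply/measurable_EFinP; exact: measurable_fun_oo.
have h : (\int[mu]_(x in `](0%R : R), 1%R[) ((EFin \o f) \_ (inner n)) x @[n --> \oo] -->
          \int[mu]_(x in `](0%R : R), 1%R[) (f x)%:E)%E.
  have [] // := @dominated_convergence _ (measurableTypeR R) R mu `]0%R, 1%R[%classic
    (measurable_itv _) (fun n => (EFin \o f) \_ (inner n)) (EFin \o f)
    (abse \o (EFin \o f)).
  - move=> n; apply/measurable_restrict => //; first exact: measurable_inner.
    exact: measurable_funS mEf.
  - apply: aeW => x x01; have [k _ kx] : (\bigcup_n inner n) x by rewrite bigcup_inner.
    apply: cvg_near_cst; near=> n.
    rewrite patchE mem_set//; apply: inner_sub kx; near: n.
    exact: nbhs_infty_ge.
  - exact: integrable_abse.
  - apply: aeW => x n _; rewrite patchE; case: ifP => _ //.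
    by rewrite abse0 abse_ge0.
have e n : (\int[mu]_(x in `](0%R : R), 1%R[) ((EFin \o f) \_ (inner n)) x =
    (F (1 - eps n) - F (eps n))%:E)%E.
  rewrite -integral_inner -integral_mkcondr (setIidr (@inner_oo n)).
  by [].
rewrite (_ : (fun n => _) = (fun n => (F (1 - eps n) - F (eps n))%:E)) in h; last first.
  by apply/funext => n; rewrite e.
apply: cvg_unique h _ => //.
apply: cvg_EFin; first exact: nearW.
by rewrite -(subrr 0); exact: cvgB.
Unshelve. all: by end_near. Qed.

End FTC.
End Exhaustion.

(** * The Jacobi weight on [0, 1]: integrability, positivity, integration by parts *)

Section JacobiWeight.
Variable R : realType.
Local Notation mu := (@lebesgue_measure R).
Implicit Types (a b s : R) (p q : {poly R}).

(** Up to a constant factor this is (1 - u)^a (1 + u)^b under u = 1 - 2s, the substitution made in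
    [sjacobi]. *)
Definition wJ a b s : R := s `^ a * (1 - s) `^ b.

Lemma wJ_ge0 a b s : 0 <= wJ a b s.
Proof. by rewrite mulr_ge0// powR_ge0. Qed.

Lemma measurable_wJ a b (D : set R) : measurable_fun D (wJ a b).
Proof.
apply: measurable_funTS.
apply: measurable_funM; first exact: measurable_powR.
by apply: (measurableT_comp (measurable_powR _)); exact: measurable_funB.
Qed.

Lemma is_derive_continuous (f : R -> R) s (df : R) :
  is_derive s 1 f df -> {for s, continuous f}.
Proof. by case=> d _; apply/differentiable_continuous/derivable1_diffP. Qed.

Lemma is_derive_powR_onem b s : s < 1 ->
  is_derive s 1 (fun t => (1 - t) `^ b) (- (b * (1 - s) `^ (b - 1))).
Proof.
move=> s1; have d1 : is_derive s 1 (fun t : R => 1 - t) (-1).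
  by apply: trigger_derive; rewrite add0r mul1r.
have s0 : 0 < 1 - s by rewrite subr_gt0.
have d2 := is_derive1_powR b s0.
have := @is_derive1_comp R (fun x : R => x `^ b) (fun t : R => 1 - t) s _ _ d2 d1.
by rewrite mulrN1.
Qed.

Lemma continuous_wJ a b : {in `](0 : R), 1[, continuous (wJ a b)}.
Proof.
move=> s; rewrite in_itv/= => /andP[s0 s1]; apply: cvgM.
  exact: (is_derive_continuous (is_derive1_powR a s0)).
exact: (is_derive_continuous (is_derive_powR_onem b s1)).
Qed.

(** The antiderivative s^(a+1) / (a+1) stays bounded on (0, 1) because a + 1 is positive. *)
Lemma integrable_powR a : -1 < a ->
  mu.-integrable `](0 : R), 1[%classic (EFin \o (fun s => s `^ a)).
Proof.
move=> a1; have a10 : 0 < a + 1 by rewrite -ltrBlDr sub0r.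
apply: (@ge0_integrable_oo R (fun s => s `^ a) (fun s => (a + 1)^-1 * s `^ (a + 1))
  _ _ (a + 1)^-1).
- move=> s; rewrite in_itv/= => /andP[s0 s1].
  exact: (is_derive_continuous (is_derive1_powR a s0)).
- move=> s; rewrite in_itv/= => /andP[s0 s1].
  have := @is_deriveZ R R R (fun s => s `^ (a + 1)) (a + 1)^-1 s 1 _
    (is_derive1_powR (a + 1) s0).
  by rewrite addrK /GRing.scale/= mulKf// gt_eqF.
- by move=> s _; exact: powR_ge0.
- move=> s; rewrite in_itv/= => /andP[s0 s1].
  rewrite ger0_norm ?mulr_ge0 ?powR_ge0 ?invr_ge0 ?(ltW a10)//.
  rewrite ler_piMr ?invr_ge0 ?(ltW a10)//.
  by rewrite -[leRHS](powRr0 s) ger_powR ?s0 ?(ltW s1)// ltW.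
Qed.

Lemma integrable_powR_onem b : -1 < b ->
  mu.-integrable `](0 : R), 1[%classic (EFin \o (fun s => (1 - s) `^ b)).
Proof.
move=> b1; have b10 : 0 < b + 1 by rewrite -ltrBlDr sub0r.
apply: (@ge0_integrable_oo R (fun s => (1 - s) `^ b)
  (fun s => - (b + 1)^-1 * (1 - s) `^ (b + 1)) _ _ (b + 1)^-1).
- move=> s; rewrite in_itv/= => /andP[s0 s1].
  exact: (is_derive_continuous (is_derive_powR_onem b s1)).
- move=> s; rewrite in_itv/= => /andP[s0 s1].
  have := @is_deriveZ R R R (fun s => (1 - s) `^ (b + 1)) (- (b + 1)^-1) s 1 _
    (is_derive_powR_onem (b + 1) s1).
  by rewrite addrK /GRing.scale/= mulrNN mulKf// gt_eqF.
- by move=> s _; exact: powR_ge0.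
- move=> s; rewrite in_itv/= => /andP[s0 s1].
  have s10 : 0 < 1 - s by rewrite subr_gt0.
  rewrite mulNr normrN.
  rewrite ger0_norm ?mulr_ge0 ?powR_ge0 ?invr_ge0 ?(ltW b10)//.
  rewrite ler_piMr ?invr_ge0 ?(ltW b10)//.
  by rewrite -[leRHS](powRr0 (1 - s)) ger_powR ?s10 ?lerBlDr ?lerDl ?(ltW s0)// ltW.
Qed.

(** On [1/2, 1] the exponent -1 is the worst case: s^a <= 1/s <= 2, whatever the sign of a. *)
Lemma powR_le2 a s : -1 < a -> 2^-1 <= s <= 1 -> s `^ a <= 2.
Proof.
move=> a1 /andP[s2 s1]; have s0 : 0 < s by rewrite (lt_le_trans _ s2).
apply: (@le_trans _ _ (s `^ (-1))); first by rewrite ger_powR ?s0// ltW.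
by rewrite powR_inv1 ?(ltW s0)// -[leRHS]invrK lef_pV2 ?posrE.
Qed.

(* Each factor is at most 2 on the half of the interval away from its own
   singularity. *)
Lemma wJ_le a b s : -1 < a -> -1 < b -> s \in `](0 : R), 1[ ->
  wJ a b s <= 2 * s `^ a + 2 * (1 - s) `^ b.
Proof.
rewrite in_itv/= => a1 b1 /andP[s0 s1]; rewrite /wJ.
have [s2|s2] := leP s 2^-1.
  apply: (@le_trans _ _ (2 * s `^ a)); last by rewrite lerDl mulr_ge0 ?powR_ge0.
  rewrite mulrC ler_wpM2r ?powR_ge0// powR_le2//; lra.
apply: (@le_trans _ _ (2 * (1 - s) `^ b)).
  by rewrite ler_wpM2r ?powR_ge0// powR_le2// (ltW s1) ltW.
by rewrite lerDr mulr_ge0 ?powR_ge0.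
Qed.

Lemma integrable_wJ a b : -1 < a -> -1 < b ->
  mu.-integrable `](0 : R), 1[%classic (EFin \o wJ a b).
Proof.
move=> a1 b1; apply: (@le_integrable _ (measurableTypeR R) R mu _ _ _
  (fun s => 2%:E * (s `^ a)%:E + 2%:E * ((1 - s) `^ b)%:E)%E) => //.
- by apply/measurable_EFinP; exact: measurable_wJ.
- move=> s /= s01; rewrite ger0_norm ?wJ_ge0// lee_fin.
  by rewrite (le_trans (wJ_le a1 b1 _))// ler_norm.
- apply: integrableD => //; apply: integrableZl => //.
  + exact: integrable_powR.
  + exact: integrable_powR_onem.
Qed.

Lemma horner_bounded p s : s \in `](0 : R), 1[ -> `|p.[s]| <= \sum_(i < size p) `|p`_i|.
Proof.
rewrite in_itv/= => /andP[s0 s1]; rewrite horner_coef.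
apply: le_trans (ler_norm_sum _ _ _) _; apply: ler_sum => i _.
rewrite normrM ler_piMr// normrX exprn_ile1 ?normr_ge0// ger0_norm ?ltW//.
Qed.

Lemma measurable_horner p (D : set R) : measurable_fun D (horner p).
Proof.
apply: measurable_funTS.
by apply: continuous_measurable_fun; exact: continuous_horner.
Qed.

Lemma integrable_horner_wJ a b p : -1 < a -> -1 < b ->
  mu.-integrable `](0 : R), 1[%classic (fun s => (p.[s] * wJ a b s)%:E).
Proof.
move=> a1 b1.
apply: (@integrableMr _ (measurableTypeR R) R mu _ _ (horner p) (EFin \o wJ a b)) => //.
- exact: measurable_horner.
- exists (\sum_(i < size p) `|p`_i|); split; first exact: num_real.
  move=> x xM s s01.
  by apply: le_trans (horner_bounded p s01) _; exact: ltW.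
- exact: integrable_wJ.
Qed.

(** Raising both exponents by one multiplies the weight by s(1-s), so after differentiation the
    original weight is again a common factor, with a polynomial cofactor. *)
Lemma is_derive_wJ_horner a b p s : s \in `](0 : R), 1[ ->
  is_derive s 1 (fun t => p.[t] * wJ (a + 1) (b + 1) t)
    ((((a + 1) *: (1 - 'X) - (b + 1) *: 'X) * p + 'X * (1 - 'X) * p^`()).[s]
     * wJ a b s).
Proof.
rewrite in_itv/= => /andP[s0 s1].
have d1 := is_derive1_powR (a + 1) s0.
have d2 := is_derive_powR_onem (b + 1) s1.
rewrite addrK in d1; rewrite addrK in d2.
have d3 := is_derive_poly p s.
have d4 := is_deriveM d3 (is_deriveM d1 d2).
apply: (is_derive_eq d4).
have s10 : 0 < 1 - s by rewrite subr_gt0.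
rewrite /GRing.scale/= /wJ.
have e1 : s `^ (a + 1) = s `^ a * s.
  by rewrite powRD ?powRr1 ?ltW// (gt_eqF s0) implybT.
have e2 : (1 - s) `^ (b + 1) = (1 - s) `^ b * (1 - s).
  by rewrite powRD ?powRr1 ?ltW// (gt_eqF s10) implybT.
rewrite !fctE e1 e2 !hornerE/=; ring.
Qed.

(** Linear factors are split off one at a time. The point is that the zeros form a finite, hence
    Lebesgue-null, set. *)
Lemma poly_roots_seq (F : fieldType) (p : {poly F}) : p != 0 ->
  exists rs : seq F, forall x, root p x -> x \in rs.
Proof.
have [n] := ubnP (size p); elim: n p => // n IH p sp p0.
have [[x /factor_theorem[q pq]]|nr] := pselect (exists x, root p x); last first.
  by exists [::] => x rx; case: nr; exists x.
have q0 : q != 0 by apply: contraNneq p0 => q0; rewrite pq q0 mul0r.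
have [|rs Hrs] := IH q _ q0.
  by move: sp; rewrite pq size_Mmonic ?monicXsubC// size_XsubC addn2.
exists (x :: rs) => y; rewrite pq rootM root_XsubC inE.
by case/orP => [/Hrs ->|->]; rewrite ?orbT.
Qed.

Section jint.
Variables a b : R.
Hypotheses (a1 : -1 < a) (b1 : -1 < b).

Definition jint p : R := \int[mu]_(s in `[0, 1]) (p.[s] * wJ a b s).

Lemma integrable_jint p :
  mu.-integrable `[(0 : R), 1]%classic (EFin \o (fun s => p.[s] * wJ a b s)).
Proof.
have /integrableP[mp ip] := integrable_horner_wJ p a1 b1.
have m (D : set R) : measurable_fun D (fun s => p.[s] * wJ a b s).
  by apply: measurable_funM; [exact: measurable_horner | exact: measurable_wJ].
apply/integrableP; split; first by apply/measurable_EFinP; exact: m.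
rewrite integral_itv_bndoo//.
by apply: measurableT_comp => //; apply/measurable_EFinP; exact: m.
Qed.

Lemma EFin_jint p :
  (jint p)%:E = (\int[mu]_(s in `[0%R, 1%R]) (p.[s] * wJ a b s)%:E)%E.
Proof. by rewrite /jint /Rintegral fineK//; exact/integrable_fin_num/integrable_jint. Qed.

Lemma jintD p q : jint (p + q) = jint p + jint q.
Proof.
rewrite /jint -RintegralD//; [|exact: integrable_jint..].
by apply: eq_Rintegral => s _; rewrite hornerD mulrDl.
Qed.

Lemma jintZ (c : R) p : jint (c *: p) = c * jint p.
Proof.
rewrite /jint -(@RintegralZl _ (measurableTypeR R) R mu _ _ c _ (integrable_jint p))//.
by apply: eq_Rintegral => s _; rewrite hornerZ -mulrA.
Qed.

Lemma jint_ge0 p : {in `[(0 : R), 1], forall s, 0 <= p.[s]} -> 0 <= jint p.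
Proof.
move=> p0; apply: Rintegral_ge0 => s s01.
by rewrite mulr_ge0 ?wJ_ge0//; exact: p0.
Qed.

(** If the integral were 0, the integrand would vanish off a null set N. The weight is positive
    inside (0, 1), so the points of [0, 1] outside N are endpoints or roots of p; then [0, 1] itself
    would be null. *)
Lemma jint_sqr_gt0 p : p != 0 -> 0 < jint (p ^+ 2).
Proof.
move=> p0; have ge0 : 0 <= jint (p ^+ 2).
  by apply: jint_ge0 => s _; rewrite horner_exp sqr_ge0.
rewrite lt_neqAle ge0 andbT; apply/eqP => /esym/eqP.
rewrite -eqe EFin_jint => /eqP i0.
pose f s : \bar R := ((p ^+ 2).[s] * wJ a b s)%:E.
have f0 s : (0 <= f s)%E.
  by rewrite lee_fin mulr_ge0 ?wJ_ge0// horner_exp sqr_ge0.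
have mf : measurable_fun `[(0 : R), 1]%classic f.
  exact: measurable_int (integrable_jint (p ^+ 2)).
have : (\int[mu]_(s in `[0%R, 1%R]) `|f s| = 0)%E.
  by rewrite -[RHS]i0; apply: eq_integral => s _; rewrite gee0_abs.
move/(ae_eq_integral_abs mu (measurable_itv _) mf) => -[N [mN N0 fN]].
have [rs Hrs] := poly_roots_seq p0.
have : (mu (`[0%R, 1%R]%classic `\` N) = 0)%E.
  apply: countable_lebesgue_measure0.
  apply: (@sub_countable _ _ _ [set` [:: 0, 1 & rs]]); last first.
    exact/finite_set_countable/finite_seq.
  apply: subset_card_le => s [s01 Ns].
  have fs : f s = 0%E by apply: contrapT => fs; apply: Ns; apply: fN => /(_ s01).
  move: s01 fs; rewrite /= in_itv/= => /andP[s0 s1] [].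
  rewrite horner_exp !inE.
  have [->|sn0] := eqVneq s 0; first by [].
  have [->|sn1] := eqVneq s 1; first by [].
  move/eqP; rewrite !mulf_eq0 !powR_eq0 subr_eq0 (negPf sn0) (eq_sym 1) (negPf sn1)/=.
  by rewrite !orbF orbb => /Hrs.
move=> h; have mc : measurable (`[(0 : R), 1]%classic `\` N).
  by apply: measurableD => //; exact: measurable_itv.
have : (mu `[0%R, 1%R]%classic <= 0)%E.
  apply: (@le_trans _ _ (mu ((`[0%R, 1%R]%classic `\` N) `|` N))).
    apply: le_measure; rewrite ?inE//; first exact: measurableU.
    by move=> s s01; have [sN|sN] := pselect (N s); [right | left].
  apply: (le_trans (measureU2 mu mc mN)); rewrite -(adde0 0%E).
  by apply: leeD; rewrite le_eqVlt; apply/orP; left; apply/eqP; [exact: h|exact: N0].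
by rewrite lebesgue_measure_itv/= lte01 oppr0 addr0 lee_fin ler10.
Qed.

(** The integrand is the derivative of p(s) s(1-s) w(s), whose boundary values vanish because a + 1
    and b + 1 are positive. *)
Lemma jint_ibp p :
  jint (((a + 1) *: (1 - 'X) - (b + 1) *: 'X) * p + 'X * (1 - 'X) * p^`()) = 0.
Proof.
set g := (X in jint X); apply/EFin_inj; rewrite EFin_jint.
have m : measurable_fun setT (fun s => g.[s] * wJ a b s).
  by apply: measurable_funM; [exact: measurable_horner | exact: measurable_wJ].
rewrite integral_itv_bndoo; last first.
  by apply/measurable_EFinP; exact: measurable_funTS.
have [a10 b10] : 0 < a + 1 /\ 0 < b + 1 by rewrite -!ltrBlDr !sub0r.
have e0 : (n.+3%:R^-1 : R) @[n --> \oo] --> 0.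
  by have := @cvg_harmonic R; rewrite -(cvg_shiftn 2); under eq_fun do rewrite addn2.
have F0 c : 0 < c -> (n.+3%:R^-1 : R) `^ c @[n --> \oo] --> 0.
  by move=> /powR_cvg0 /cvg_at_rightP; apply; split=> // n; rewrite invr_gt0.
have p01 n : (n.+3%:R^-1 : R) \in `](0 : R), 1[.
  by rewrite in_itv/= invr_gt0 ltr0n/= invf_lt1 ?ltr0n// ltr1n.
have q01 n : (1 - n.+3%:R^-1 : R) \in `](0 : R), 1[.
  by move: (p01 n); rewrite !in_itv/= => /andP[h1 h2]; rewrite subr_gt0 h2 gtrBl.
pose M := \sum_(i < size p) `|p`_i|.
have M0 : 0 <= M by exact: sumr_ge0.
have powR_le1 c x : 0 < c -> x \in `](0 : R), 1[ -> x `^ c <= 1.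
  rewrite in_itv/= => /ltW c0 /andP[x0 /ltW x1].
  by rewrite -[leRHS](powRr0 x) ger_powR ?x0.
(* Near 0, p is at most M and (1-s)^(b+1) at most 1, so the boundary value is bounded by M s^(a+1).
   [key'] is the mirror image at 1. *)
have key n : `|p.[n.+3%:R^-1] * wJ (a + 1) (b + 1) n.+3%:R^-1|
   <= M * n.+3%:R^-1 `^ (a + 1).
  rewrite normrM ler_pM// ?horner_bounded// ger0_norm ?wJ_ge0// /wJ.
  by rewrite ler_piMr ?powR_ge0// powR_le1.
have key' n : `|p.[1 - n.+3%:R^-1] * wJ (a + 1) (b + 1) (1 - n.+3%:R^-1)|
   <= M * n.+3%:R^-1 `^ (b + 1).
  rewrite normrM ler_pM// ?horner_bounded// ger0_norm ?wJ_ge0// /wJ subKr.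
  by rewrite ler_piMl ?powR_ge0// powR_le1.
have sq (u v : R ^nat) : v n @[n --> \oo] --> 0 -> (forall n, `|u n| <= v n) ->
    u n @[n --> \oo] --> 0.
  move=> v0 uv; apply/norm_cvg0P.
  by apply: (squeeze_cvgr _ (cvg_cst 0) v0); apply: nearW => n; rewrite normr_ge0 uv.
apply: (@integral_oo_eq0 R (fun s => g.[s] * wJ a b s)
  (fun s => p.[s] * wJ (a + 1) (b + 1) s)).
- move=> s s01; apply: cvgM; first exact: continuous_horner.
  exact: continuous_wJ.
- by move=> s s01; exact: is_derive_wJ_horner.
- exact: integrable_horner_wJ.
- by apply: sq key; rewrite -(mulr0 M); apply: cvgMr; exact: F0.
- by apply: sq key'; rewrite -(mulr0 M); apply: cvgMr; exact: F0.
Qed.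
End jint.

End JacobiWeight.

(** * The Sturm-Liouville operator, its Jacobi eigenvectors and the univariate Bernstein
    inequality *)

Section SturmLiouville.
Variable R : realType.
Variables a b : R.
Hypotheses (a1 : -1 < a) (b1 : -1 < b).
Implicit Types (p q : {poly R}).
Local Notation jint := (jint a b).

Definition eigen (n : nat) : R := n%:R * (n%:R + a + b + 1).

Definition jop p : {poly R} :=
  - ('X * (1 - 'X) * p^`()^`() + ((a + 1) *: (1 - 'X) - (b + 1) *: 'X) * p^`()).

Definition dirichlet p q := jint ('X * (1 - 'X) * (p^`() * q^`())).

(** The two integrands differ by the total derivative of [jint_ibp] taken at p'q, so no boundary
    term survives. *)
Lemma jint_jop p q : jint (jop p * q) = dirichlet p q.
Proof.
rewrite -[RHS]addr0 -[X in _ + X](mulr0 (-1)) -(jint_ibp a1 b1 (p^`() * q)).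
by rewrite -jintZ// -jintD//; congr jint; rewrite /jop derivM -!mul_polyC; ring.
Qed.

Lemma dirichletC p q : dirichlet p q = dirichlet q p.
Proof. by rewrite /dirichlet [p^`() * _]mulrC. Qed.

(** On monomial coefficients the operator is bidiagonal, which turns the eigenvalue equation into a
    two-term recurrence. *)
Lemma coef_jop p v : (jop p)`_v =
  v%:R * (v%:R + a + b + 1) * p`_v - v.+1%:R * (v%:R + a + 1) * p`_v.+1.
Proof.
have -> : jop p = - (p^`()^`() * 'X - p^`()^`() * 'X * 'X +
    ((a + 1) *: p^`() - (a + b + 2) *: (p^`() * 'X))).
  rewrite /jop -!mul_polyC !(polyCD, polyC1); ring.
rewrite !(coefN, coefD, coefZ, coefMX).
case: v => [|[|v]] /=; rewrite ?coef_deriv.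
- ring.
- ring.
- rewrite -!natr1; ring.
Qed.

(* jacobi is a sum over powers of (t - 1)/2, which is -s when t = 1 - 2s. *)
Definition sjcoef n v : R := (-1) ^+ v *
    ((\prod_(1 <= j < v.+1) (n%:R + a + b + j%:R))
     * (\prod_(v.+1 <= j < n.+1) (a + j%:R))
     / (v`!%:R * (n - v)`!%:R)).

Lemma sjacobiE n : sjacobi n a b = \poly_(v < n.+1) sjcoef n v.
Proof.
rewrite /sjacobi /jacobi poly_def raddf_sum; apply: eq_bigr => v _ /=.
rewrite linearZ/= rmorphXn/= linearZ/= linearB/= comp_polyX rmorph1.
have -> : 1 - 2 *: 'X - 1 = - (2 *: 'X) :> {poly R} by ring.
rewrite scalerN scalerA mulVf ?pnatr_eq0// scale1r.
by rewrite exprNn -signr_odd mulr_sign -scaler_sign signr_odd scalerA mulrC.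
Qed.

(** This is the recurrence demanded by [coef_jop]. The ratio of consecutive coefficients matches it
    since eigen n - v(v+a+b+1) = (n-v)(n+v+a+b+1). *)
Lemma sjcoefS n v : (v < n)%N ->
  v.+1%:R * (v%:R + a + 1) * sjcoef n v.+1 =
  (v%:R * (v%:R + a + b + 1) - eigen n) * sjcoef n v.
Proof.
move=> vn; rewrite /sjcoef /eigen.
rewrite (big_nat_recr v.+1)//= (big_ltn (m := v.+1))//.
have -> : (n - v)%N = (n - v.+1).+1 by rewrite subnSK.
(* With m = n - v - 1, both n and the truncated difference n - v become polynomial in v and m, as
   [field] requires. *)
have -> : n%:R = v%:R + 1 + (n - v.+1)%:R :> R by rewrite natr1 -natrD subnKC.
set m := (n - v.+1)%N; rewrite !factS !natrM exprS -!natr1.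
set P1 := \prod_(_ <= _ < _) _; set P2 := \prod_(_ <= _ < _) _.
have f1 : v`!%:R != 0 :> R by rewrite pnatr_eq0 -lt0n fact_gt0.
have f2 : m`!%:R != 0 :> R by rewrite pnatr_eq0 -lt0n fact_gt0.
have f3 : v%:R + 1 != 0 :> R by rewrite natr1 pnatr_eq0.
have f4 : m%:R + 1 != 0 :> R by rewrite natr1 pnatr_eq0.
by field; rewrite f1 f2 f3 f4.
Qed.

Lemma jop_sjacobi n : jop (sjacobi n a b) = eigen n *: sjacobi n a b.
Proof.
apply/polyP => v; rewrite coef_jop coefZ sjacobiE !coef_poly !ltnS.
have [vn|nv|->] := ltngtP v n.
- by rewrite sjcoefS// mulrBl opprB addrC subrK.
- by rewrite !mulr0 subrr.
- by rewrite mulr0 subr0.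
Qed.

Lemma sjcoef_neq0 n : sjcoef n n != 0.
Proof.
rewrite /sjcoef mulf_neq0 ?signr_eq0// mulf_neq0//.
rewrite (big_geq (leqnn n.+1)) mulr1 prodf_seq_neq0; apply/allP => j.
rewrite mem_index_iota => /andP[j1 jn]; apply/implyP => _.
(* Here 1 <= j <= n, so n + j >= 2, which outweighs a + b > -2. For n = 0 the product is empty. *)
rewrite gt_eqF//.
have j1R : 1 <= j%:R :> R by rewrite ler1n.
have jnR : j%:R <= n%:R :> R by rewrite ler_nat.
move: (a1) (b1) => a1' b1'; lra.
Qed.

Lemma size_sjacobi n : size (sjacobi n a b) = n.+1.
Proof. by rewrite sjacobiE size_poly_eq// sjcoef_neq0. Qed.

Lemma dirichlet_sjacobi n p :
  dirichlet (sjacobi n a b) p = eigen n * jint (sjacobi n a b * p).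
Proof. by rewrite -jint_jop jop_sjacobi -scalerAl jintZ. Qed.

(** The difference factors as (n-m)(n+m+a+b+1). The second factor is positive even when a + b + 1 is
    negative, because m < n forces n >= 1. *)
Lemma eigen_lt m n : (m < n)%N -> eigen m < eigen n.
Proof.
move=> mn; rewrite -subr_gt0.
have -> : eigen n - eigen m = (n%:R - m%:R) * (n%:R + m%:R + a + b + 1).
  by rewrite /eigen; ring.
have n1 : 1 <= n%:R :> R by rewrite ler1n (leq_trans _ mn).
have m0 : 0 <= m%:R :> R by [].
by rewrite mulr_gt0 ?subr_gt0 ?ltr_nat//; move: (a1) (b1) => a1' b1'; lra.
Qed.

Lemma eigen_ge0 n : 0 <= eigen n.
Proof.
case: n => [|n]; first by rewrite /eigen mul0r.
by rewrite (le_trans _ (ltW (eigen_lt (ltn0Sn n))))// /eigen mul0r.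
Qed.

Lemma poly_decomp (Q p : {poly R}) n : size Q = n.+1 -> (size p <= n.+1)%N ->
  exists c r, p = c *: Q + r /\ (size r <= n)%N.
Proof.
move=> sQ sp; have Qn : Q`_n != 0.
  by have := lead_coef_eq0 Q; rewrite lead_coefE sQ/= => ->; rewrite -size_poly_eq0 sQ.
exists (p`_n / Q`_n), (p - (p`_n / Q`_n) *: Q); split; first by rewrite addrC subrK.
apply/leq_sizeP => j; rewrite leq_eqVlt => /predU1P[<-|nj].
  by rewrite coefB coefZ mulfVK// subrr.
have pj := leq_trans sp nj.
have Qj : (size Q <= j)%N by rewrite sQ.
by rewrite coefB coefZ (nth_default _ pj) (nth_default _ Qj) mulr0 subrr.
Qed.

(** The Q m with m < n have exact degrees 0, ..., n-1, hence span the polynomials of degree below n.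
    This serves both for Jacobi polynomials and for an arbitrary orthogonal family. *)
Lemma jint_orth (P : {poly R}) (Q : nat -> {poly R}) n :
  (forall m, size (Q m) = m.+1) -> (forall m, (m < n)%N -> jint (P * Q m) = 0) ->
  forall p, (size p <= n)%N -> jint (P * p) = 0.
Proof.
move=> sQ PQ p sp.
suff H m : (m <= n)%N -> forall p, (size p <= m)%N -> jint (P * p) = 0 by exact: (H n).
elim: m => [_ {sp}p|m IH mn {sp}p sp].
  by rewrite leqn0 size_poly_eq0 => /eqP ->; rewrite mulr0 -(scale0r 0) jintZ// mul0r.
have [c [r [-> sr]]] := poly_decomp (sQ m) sp.
by rewrite mulrDr jintD// -scalerAr jintZ// PQ// mulr0 add0r IH// ltnW.
Qed.

(** Evaluating the symmetric energy from either side shows that the difference of two eigenvalues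
    times the inner product is 0, and distinct degrees have distinct eigenvalues. *)
Lemma jint_sjacobi n p : (size p <= n)%N -> jint (sjacobi n a b * p) = 0.
Proof.
apply: jint_orth size_sjacobi _ _ => m mn.
have := dirichlet_sjacobi n (sjacobi m a b).
rewrite dirichletC dirichlet_sjacobi mulrC [sjacobi n _ _ * _]mulrC => /eqP.
rewrite mulrC -subr_eq0 -mulrBl mulf_eq0 => /orP[|/eqP//].
by rewrite subr_eq0 lt_eqF// eigen_lt.
Qed.

Lemma dirichletD p q r : dirichlet (p + q) r = dirichlet p r + dirichlet q r.
Proof. by rewrite /dirichlet derivD -jintD//; congr jint; ring. Qed.

Lemma dirichletZ (c : R) p q : dirichlet (c *: p) q = c * dirichlet p q.
Proof. by rewrite /dirichlet derivZ -jintZ//; congr jint; rewrite -!mul_polyC; ring. Qed.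

(** Induction peels off the top Jacobi component. It is orthogonal to the remainder both in the
    weighted L^2 product and in energy, and the remainder satisfies the bound with a smaller
    eigenvalue. *)
Lemma jacobi_bernstein n p : (size p <= n.+1)%N ->
  dirichlet p p <= eigen n * jint (p ^+ 2).
Proof.
elim: n p => [|n IH] p sp.
  have -> : dirichlet p p = 0.
    rewrite /dirichlet (size1_polyC sp) derivC mul0r mulr0.
    by rewrite -(scale0r 0) jintZ// mul0r.
  by rewrite /eigen !mul0r.
have [c [r [-> sr]]] := poly_decomp (size_sjacobi n.+1) sp.
set J := sjacobi _ _ _.
have Jr : jint (J * r) = 0 by exact: jint_sjacobi.
have Dr : dirichlet J r = 0 by rewrite dirichlet_sjacobi Jr mulr0.
have -> : dirichlet (c *: J + r) (c *: J + r) =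
    c ^+ 2 * (eigen n.+1 * jint (J ^+ 2)) + dirichlet r r.
  rewrite dirichletD (dirichletC (c *: J)) (dirichletC r) !dirichletD !dirichletZ.
  rewrite (dirichletC _ (c *: J)) dirichletZ (dirichletC r) dirichletZ Dr.
  rewrite dirichlet_sjacobi -/J expr2; ring.
have -> : jint ((c *: J + r) ^+ 2) = c ^+ 2 * jint (J ^+ 2) + jint (r ^+ 2).
  have -> : (c *: J + r) ^+ 2 = c ^+ 2 *: J ^+ 2 + r ^+ 2 + (2 * c) *: (J * r).
    by rewrite -!mul_polyC; ring.
  by rewrite !jintD// !jintZ// Jr mulr0 addr0.
rewrite mulrDr mulrCA lerD2l (le_trans (IH r sr))// ler_wpM2r//.
  by apply: jint_ge0 => s _; rewrite horner_exp sqr_ge0.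
by rewrite ltW// eigen_lt.
Qed.

Lemma dirichlet_scale_sjacobi n (c : R) :
  dirichlet (c *: sjacobi n a b) (c *: sjacobi n a b) =
  eigen n * jint ((c *: sjacobi n a b) ^+ 2).
Proof.
rewrite dirichletZ dirichletC dirichletZ dirichlet_sjacobi exprZn jintZ// expr2.
ring.
Qed.

(** Subtracting the multiple of the Jacobi polynomial with the same leading coefficient leaves r of
    lower degree. Both polynomials are orthogonal to r, so r is orthogonal to itself and
    vanishes. *)
Lemma orth_sjacobi (P : nat -> {poly R}) n :
  (forall m, size (P m) = m.+1) ->
  (forall m l, m != l -> jint (P m * P l) = 0) ->
  exists c, P n = c *: sjacobi n a b.
Proof.
move=> sP oP.
have sPn : (size (P n) <= n.+1)%N by rewrite sP.
have [c [r [Pn sr]]] := poly_decomp (size_sjacobi n) sPn.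
exists c; suff r0 : r = 0 by rewrite Pn r0 addr0.
have Pr : jint (P n * r) = 0.
  by apply: jint_orth sP _ _ sr => m mn; rewrite oP// gt_eqF.
apply/eqP; apply: contraT => /(jint_sqr_gt0 a1 b1).
have -> : r ^+ 2 = P n * r + (- c) *: (sjacobi n a b * r).
  by rewrite Pn -!mul_polyC polyCN; ring.
by rewrite jintD// jintZ// Pr jint_sjacobi// mulr0 addr0 ltxx.
Qed.

End SturmLiouville.

(** * The linear change of variable x = c s *)

Section Scaling.
Variable R : realType.
Local Notation mu := (@lebesgue_measure R).
Variable c : R.
Hypothesis c0 : 0 < c.

Let phi (s : measurableTypeR R) : measurableTypeR R := c * s.

Let mphi : measurable_fun setT phi.
Proof. exact: measurable_funM. Qed.

Let phi_itv b1 b2 x y : phi @^-1` [set` Interval (BSide b1 x) (BSide b2 y)] =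
  [set` Interval (BSide b1 (x / c)) (BSide b2 (y / c))].
Proof.
apply/seteqP; split => s; rewrite /phi /= !itv_boundlr /= !leBSide /=;
  by rewrite lteif_pdivrMr// lteif_pdivlMr// ![_ * c]mulrC.
Qed.

Let scaled : {measure set (measurableTypeR R) -> \bar R}.
Proof.
refine (mscale (NngNum (ltW c0)) (pushforward mu phi : {measure set _ -> \bar R})).
exact: mphi.
Defined.

(** By uniqueness of Lebesgue measure it is enough to compare on intervals: the preimage divides the
    length by c and [mscale] restores it. *)
Let lebesgue_scaled A : measurable A -> mu A = scaled A.
Proof.
apply: lebesgue_measure_unique => _ [[x y]] _ <-.
rewrite /scaled /= /mscale/= /pushforward phi_itv !lebesgue_measure_itv/=.
rewrite !lte_fin ltr_pM2r ?invr_gt0//.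
case: ifP => _; last by rewrite mule0.
by rewrite -!EFinB -EFinM -mulrBl mulrCA mulfV ?gt_eqF// mulr1.
Qed.

Lemma ge0_integral_scale (f : R -> \bar R) :
  measurable_fun setT f -> (forall x, 0 <= f x)%E ->
  (\int[mu]_(x in `[0%R, c]) f x = c%:E * \int[mu]_(s in `[0%R, 1%R]) f (c * s)%R)%E.
Proof.
move=> mf f0; have mD (D : set R) : measurable_fun D f by exact: measurable_funTS.
rewrite (eq_measure_integral scaled); last by move=> A mA _; exact: lebesgue_scaled.
rewrite ge0_integral_mscale//; last exact: mD.
rewrite ge0_integral_pushforward//=; last exact: mD.
by rewrite phi_itv mul0r divff ?gt_eqF.
Qed.

End Scaling.

(** * Pulling the weighted norm back to the unit square *)

Section Pullback.
Variable R : realType.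
Local Notation mu := (@lebesgue_measure R).
Variables alpha beta gamma delta : R.

(** The Jacobian 2-y and the powers gamma and delta produced by x = (2-y)s and 2-x-y = (2-y)(1-s)
    cancel exactly against the exponent -(gamma+delta+1) in W. *)
Lemma W_pullback (s y : R) : 0 <= s <= 1 -> 0 <= y <= 1 ->
  (2 - y) * W alpha beta gamma delta ((2 - y) * s, y) =
  wJ gamma delta s * wJ alpha beta y.
Proof.
move=> /andP[s0 s1] /andP[y0 y1]; have c0 : 0 < 2 - y by lra.
have s10 : 0 <= 1 - s by rewrite subr_ge0.
rewrite /W /wJ /=; have -> : 2 - (2 - y) * s - y = (2 - y) * (1 - s) by ring.
rewrite !powRM ?(ltW c0)//.
have e : (2 - y) * ((2 - y) `^ gamma * (2 - y) `^ delta *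
    (2 - y) `^ (- (gamma + delta + 1))) = 1.
  have D x z : (2 - y) `^ (x + z) = (2 - y) `^ x * (2 - y) `^ z.
    by rewrite powRD// (gt_eqF c0) implybT.
  rewrite -{1}(powRr1 (ltW c0)) -!D.
  have -> : 1 + (gamma + delta - (gamma + delta + 1)) = 0 by ring.
  exact: powRr0.
rewrite -[RHS]mul1r -[X in _ = X * _]e; ring.
Qed.

Lemma measurable_trapezoid : measurable (@trapezoid R).
Proof.
have -> : @trapezoid R = (snd @^-1` `[0, 1]) `&` (fst @^-1` `[0, +oo[)
    `&` ((fun z : R * R => 2 - z.2 - z.1) @^-1` `[0, +oo[).
  apply/seteqP; split => -[x y]; rewrite /trapezoid/= !in_itv/= !andbT subr_ge0.
    by case=> -> /andP[-> ->].
  by case=> -[-> ->] ->.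
apply: measurableI; first apply: measurableI.
- rewrite -[X in measurable X]setTI; apply: measurable_snd => //.
- rewrite -[X in measurable X]setTI; apply: measurable_fst => //.
- rewrite -[X in measurable X]setTI.
  apply: (_ : measurable_fun setT (fun z : R * R => 2 - z.2 - z.1)) => //.
  apply: measurable_funB => //.
  apply: measurable_funB => //.
Qed.

Lemma measurable_W : measurable_fun setT (W alpha beta gamma delta).
Proof.
have mp (a : R) (g : R * R -> R) : measurable_fun setT g ->
    measurable_fun setT (fun z => g z `^ a).
  by move=> mg; apply: (measurableT_comp (measurable_powR _)).
rewrite /W; do !apply: measurable_funM; apply: mp => //;
 by do ?apply: measurable_funB.
Qed.

(** Tonelli with y outermost, then x = (2-y)s on each horizontal segment [0, 2-y]; for y outside
    [0, 1] the segment is empty. *)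
Lemma normsq_pullback (u : R * R -> R) : measurable_fun setT u ->
  (normsq alpha beta gamma delta u =
   \int[mu]_(y in `[0%R, 1%R]) \int[mu]_(s in `[0%R, 1%R])
     (u ((2 - y) * s, y) ^+ 2 * (wJ gamma delta s * wJ alpha beta y))%:E)%E.
Proof.
move=> mu_; rewrite /normsq integral_mkcond.
pose g z : \bar R := (`|u z| ^+ 2 * W alpha beta gamma delta z)%:E.
have g0 z : (0 <= g z)%E.
  by rewrite lee_fin mulr_ge0 ?exprn_ge0// !mulr_ge0 ?powR_ge0.
have mg : measurable_fun setT g.
  apply/measurable_EFinP/measurable_funM; last exact: measurable_W.
  by apply: measurable_funX; apply: measurableT_comp.
rewrite fubini_tonelli2; last 2 first.
- apply/(measurable_restrictT g) => //; first exact: measurable_trapezoid.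
  exact: measurable_funTS.
- by move=> z; apply: erestrict_ge0 => t _; exact: g0.
rewrite [RHS]integral_mkcond; apply: eq_integral => y _.
rewrite /fubini_G patchE; case: ifPn => y01; last first.
  move: y01; rewrite notin_setE/= in_itv/= => y01.
  apply: integral0_eq => x _; rewrite patchE; case: ifPn => //.
  by rewrite inE => -[/= yy _]; case: y01.
move: y01; rewrite inE/= in_itv/= => y01.
have c0 : 0 < 2 - y by move: y01 => /andP[y0 y1]; lra.
transitivity (\int[mu]_(x in `[0%R, (2 - y)%R]) g (x, y))%E.
  rewrite [RHS]integral_mkcond; apply: eq_integral => x _.
  rewrite !patchE; congr (if _ then _ else _).
  by apply/idP/idP; rewrite !inE /trapezoid/= in_itv/=; [case | split].
rewrite ge0_integral_scale//; last exact: measurableT_comp.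
rewrite -ge0_integralZl//.
- apply: eq_integral => s; rewrite inE/= in_itv/= => s01.
  rewrite /g real_normK ?num_real// -EFinM; congr _%:E.
  by rewrite mulrCA W_pullback.
- have m2 : measurable_fun setT (fun s : R => ((2 - y) * s, y)).
    by apply: measurable_fun_pair => //; exact: measurable_funM.
  by apply: measurable_funTS; exact: (measurableT_comp mg m2).
- by rewrite lee_fin ltW.
Qed.

End Pullback.

(** * Restricting a bivariate polynomial to polynomial curves *)

Section Slices.
Variable R : realType.
Implicit Types (f : mpoly 2 R) (h : 'I_2 -> {poly R}).

(** The coordinates are replaced by arbitrary univariate polynomials, so that degree bound and chain
    rule are proved once for both families of fibers. *)
Definition mslice h f : {poly R} := mmap (@polyC R) h f.

Lemma msliceE h f : mslice h f =
  \sum_(m <- msupp f) mcoeff m f *: (h iX ^+ m iX * h iY ^+ m iY).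
Proof.
apply: eq_bigr => m _; rewrite mul_polyC; congr (_ *: _).
by rewrite /mmap1 big_ord_recl big_ord1 (_ : lift ord0 ord0 = iY)//; exact/val_inj.
Qed.

Lemma eval2E f (z : R * R) : eval2 f z =
  \sum_(m <- msupp f) mcoeff m f * (z.1 ^+ m iX * z.2 ^+ m iY).
Proof.
rewrite /eval2 mevalE; apply: eq_bigr => m _; congr (_ * _).
by rewrite big_ord_recl big_ord1 (_ : lift ord0 ord0 = iY)//; exact/val_inj.
Qed.

Lemma horner_mslice h f t : (mslice h f).[t] = eval2 f ((h iX).[t], (h iY).[t]).
Proof.
rewrite msliceE eval2E horner_sum; apply: eq_bigr => m _.
by rewrite hornerZ hornerM !horner_exp.
Qed.

(** A monomial of total degree d becomes a product of d factors of degree at most one. *)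
Lemma size_mslice h f : (forall i, (size (h i) <= 2)%N) ->
  (size (mslice h f) <= msize f)%N.
Proof.
move=> sh; rewrite msliceE; apply: (leq_trans (size_sum _ _ _)).
apply/bigmax_leqP_seq => m mf _; apply: (leq_trans (size_scale_leq _ _)).
apply: leq_trans (msize_mdeg_lt mf).
rewrite mdegE big_ord_recl big_ord1 (_ : lift ord0 ord0 = iY); last exact/val_inj.
apply: leq_trans (size_polyMleq _ _) _.
have sX i : (size (h i ^+ m i) <= (m i).+1)%N.
  apply: leq_trans (size_poly_exp_leq _ _) _; rewrite ltnS -[leqRHS]mul1n leq_mul2r.
  by apply/orP; right; case: (size _) (sh i) => [|[|[|]]].
rewrite -subn1 leq_subLR add1n; apply: leq_trans (leq_add (sX iX) (sX iY)) _.
by rewrite addSn addnS.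
Qed.

Lemma deriv_mslice h f : (mslice h f)^`() =
  mslice h (mderiv iX f) * (h iX)^`() + mslice h (mderiv iY f) * (h iY)^`().
Proof.
have sD : {morph mslice h : p q / p + q} by move=> p q; exact: mmapD.
elim/mpolyind: f => [|c m f _ _ IH].
  by rewrite /mslice !mderiv0 !mmap0 deriv0 !mul0r addr0.
rewrite sD derivD IH !mderivD !sD !mulrDl addrACA; congr (_ + _).
rewrite !mderivZ /mslice !mmapZ !mderivX !mmapZ !mmapX /mmap1 !big_ord_recl !big_ord0.
rewrite (_ : lift ord0 ord0 = iY); last exact/val_inj.
(* The truncated exponent m - 1 of [mderivX] is the predecessor used by [deriv_exp], so exponent 0
   needs no separate case. *)
rewrite !mnmBE !mnm1E /= !mulr1 !subn0 !subn1.
rewrite derivM derivC derivM !deriv_exp !polyC_natr -[iX]/ord0.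
ring.
Qed.

End Slices.

(** * Tonelli on the unit square and fiberwise comparison *)

Section Fibers.
Variable R : realType.
Local Notation mu := (@lebesgue_measure R).
Local Open Scope ereal_scope.
Implicit Types K : R * R -> \bar R.

Let I : set R := `[0%R, 1%R].

Let mI : measurable I. Proof. exact: measurable_itv. Qed.

(** Extending K by 0 off the strip turns the fiber integral over [0, 1] into one over the whole
    line, where Tonelli gives measurability. *)
Lemma ge0_measurable_fiber K : measurable_fun setT K -> (forall z, 0 <= K z) ->
  measurable_fun I (fun y => \int[mu]_(s in I) K (s, y)).
Proof.
move=> mK K0; pose K' := K \_ (I `*` setT).
have mK' : measurable_fun setT K'.
  apply/(measurable_restrictT K); first exact: measurableX.
  exact: measurable_funTS.
have K'0 z : 0 <= K' z by apply: erestrict_ge0.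
apply: measurable_funTS.
rewrite (_ : (fun y => _) = fubini_G mu K').
  exact: measurable_fun_fubini_tonelli_G.
apply/funext => y; rewrite /fubini_G [LHS]integral_mkcond; apply: eq_integral => x _.
by rewrite /K' !patchE in_setX/= in_setT andbT.
Qed.

Lemma integral_unit_square_swap K : measurable_fun setT K -> (forall z, 0 <= K z) ->
  \int[mu]_(y in I) \int[mu]_(x in I) K (x, y) =
  \int[mu]_(x in I) \int[mu]_(y in I) K (x, y).
Proof.
move=> mK K0; pose K' := K \_ (I `*` I).
have mK' : measurable_fun setT K'.
  apply/(measurable_restrictT K); first exact: measurableX.
  exact: measurable_funTS.
have K'0 z : 0 <= K' z by apply: erestrict_ge0.
transitivity (\int[mu]_y \int[mu]_x K' (x, y)).
  rewrite [LHS]integral_mkcond; apply: eq_integral => y _; rewrite patchE.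
  case: ifPn => yI.
    rewrite [LHS]integral_mkcond; apply: eq_integral => x _.
    by rewrite /K' !patchE in_setX/= yI andbT.
  by rewrite integral0_eq// => x _; rewrite /K' patchE in_setX/= (negPf yI) andbF.
transitivity (\int[mu]_x \int[mu]_y K' (x, y)); first exact/esym/fubini_tonelli.
rewrite [RHS]integral_mkcond; apply: eq_integral => x _; rewrite patchE.
case: ifPn => xI.
  rewrite [RHS]integral_mkcond; apply: eq_integral => y _.
  by rewrite /K' !patchE in_setX/= xI.
by rewrite integral0_eq// => y _; rewrite /K' patchE in_setX/= (negPf xI).
Qed.

Lemma le_integral_fibers K1 K2 (c : R) :
  measurable_fun setT K1 -> (forall z, 0 <= K1 z) ->
  measurable_fun setT K2 -> (forall z, 0 <= K2 z) -> (0 <= c)%R ->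
  (forall y, I y -> \int[mu]_(s in I) K1 (s, y) <= c%:E * \int[mu]_(s in I) K2 (s, y)) ->
  \int[mu]_(y in I) \int[mu]_(s in I) K1 (s, y) <=
  c%:E * \int[mu]_(y in I) \int[mu]_(s in I) K2 (s, y).
Proof.
move=> mK1 K10 mK2 K20 c0 K12.
have m1 := ge0_measurable_fiber mK1 K10; have m2 := ge0_measurable_fiber mK2 K20.
rewrite -ge0_integralZl//; last by move=> y _; exact: integral_ge0.
apply: ge0_le_integral => //; first by move=> y _; exact: integral_ge0.
exact: measurable_funeM.
Qed.

Lemma eq_integral_fibers K1 K2 (c : R) :
  measurable_fun setT K2 -> (forall z, 0 <= K2 z) -> (0 <= c)%R ->
  (forall y, I y -> \int[mu]_(s in I) K1 (s, y) = c%:E * \int[mu]_(s in I) K2 (s, y)) ->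
  \int[mu]_(y in I) \int[mu]_(s in I) K1 (s, y) =
  c%:E * \int[mu]_(y in I) \int[mu]_(s in I) K2 (s, y).
Proof.
move=> mK2 K20 c0 K12; have m2 := ge0_measurable_fiber mK2 K20.
rewrite -ge0_integralZl//; last by move=> y _; exact: integral_ge0.
by apply: eq_integral => y; rewrite inE => /K12.
Qed.

End Fibers.

(** * The two inequalities on the trapezoid *)

Section Trapezoid.
Variable R : realType.
Local Notation mu := (@lebesgue_measure R).
Variables alpha beta gamma delta : R.
Hypotheses (al1 : -1 < alpha) (be1 : -1 < beta) (ga1 : -1 < gamma) (de1 : -1 < delta).
Implicit Types (f : mpoly 2 R) (p P Q : {poly R}) (u : R * R -> R).
Local Notation N := (normsq alpha beta gamma delta).

Lemma eq_normsq u v : (forall z, trapezoid z -> u z = v z) -> N u = N v.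
Proof. by move=> uv; apply: eq_integral => z; rewrite inE => /uv ->. Qed.

Lemma measurable_eval2 f : measurable_fun setT (eval2 f).
Proof.
rewrite (_ : eval2 f = fun z => \sum_(m <- msupp f)
  mcoeff m f * (z.1 ^+ m iX * z.2 ^+ m iY)); last by apply/funext => z; exact: eval2E.
apply: measurable_sum => m; apply: measurable_funM => //.
by apply: measurable_funM; apply: measurable_funX.
Qed.

Lemma measurable_sqrt_comp u : measurable_fun setT u ->
  measurable_fun setT (fun z => Num.sqrt (u z)).
Proof.
move=> mu_; apply: (measurableT_comp _ mu_).
by apply: continuous_measurable_fun; exact: sqrt_continuous.
Qed.

(** Here [z] is the point (s, y) of the unit square, while u is evaluated at (x, y); the Jacobian is
    already absorbed in the product weight. *)
Definition Kpull u (z : R * R) : \bar R :=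
  (u ((2 - z.2) * z.1, z.2) ^+ 2 * (wJ gamma delta z.1 * wJ alpha beta z.2))%:E.

Lemma Kpull_ge0 u z : (0 <= Kpull u z)%E.
Proof. by rewrite lee_fin mulr_ge0 ?sqr_ge0// mulr_ge0 ?wJ_ge0. Qed.

Lemma measurable_Kpull u : measurable_fun setT u -> measurable_fun setT (Kpull u).
Proof.
move=> mu_; apply/measurable_EFinP; apply: measurable_funM.
  apply: measurable_funX; apply: (measurableT_comp mu_).
  apply: measurable_fun_pair => //; apply: measurable_funM => //.
  exact: measurable_funB.
by apply: measurable_funM; apply: (measurableT_comp (@measurable_wJ _ _ _ setT)).
Qed.

Lemma integral_fiber (a b : R) (g : R -> \bar R) p (c : R) : -1 < a -> -1 < b ->
  (forall s, 0 <= s <= 1 -> g s = (p.[s] * wJ a b s * c)%:E) ->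
  (\int[mu]_(s in `[0%R, 1%R]) g s = (jint a b p * c)%:E)%E.
Proof.
move=> a1 b1 gE; rewrite EFinM EFin_jint// -integralZr//; last exact: integrable_jint.
by apply: eq_integral => s; rewrite inE/= in_itv/= => /gE ->.
Qed.

Definition slice_x f (y : R) : {poly R} :=
  mslice (fun i => if i == iX then (2 - y) *: 'X else y%:P) f.

(** It is s that is frozen, not x: the lines x = (2-y)s pass through (0, 2) with direction
    (-x/(2-y), 1), and D_y is the derivative along them. *)
Definition slice_y f (s : R) : {poly R} :=
  mslice (fun i => if i == iX then s *: (2%:P - 'X) else 'X) f.

Lemma horner_slice_x f y s : (slice_x f y).[s] = eval2 f ((2 - y) * s, y).
Proof. by rewrite horner_mslice/= !hornerE. Qed.

Lemma horner_slice_y f y s : (slice_y f s).[y] = eval2 f ((2 - y) * s, y).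
Proof. by rewrite horner_mslice/= !hornerE mulrC. Qed.

Lemma deriv_slice_x f y s :
  (slice_x f y)^`().[s] = (2 - y) * dx f ((2 - y) * s, y).
Proof.
rewrite deriv_mslice/= derivC mulr0 addr0 derivZ derivX hornerM horner_mslice/=.
by rewrite !hornerE/= mulr1 mulrC.
Qed.

Lemma deriv_slice_y f y s : y != 2 ->
  (slice_y f s)^`().[y] = Dy f ((2 - y) * s, y).
Proof.
move=> y2; rewrite deriv_mslice/= derivZ derivB derivC derivX mulr1 sub0r.
rewrite hornerD hornerM !horner_mslice/= !hornerE/= [s * (2 - y)]mulrC /Dy /=.
have -> : (2 - y) * s / (2 - y) = s.
  by rewrite mulrAC mulfV ?mul1r// subr_eq0 eq_sym.
rewrite /dx /dy; ring.
Qed.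

Lemma size_slice_x f y : (size (slice_x f y) <= msize f)%N.
Proof.
apply: size_mslice => i; case: ifP => _.
  by rewrite (leq_trans (size_scale_leq _ _))// size_polyX.
by rewrite (leq_trans (size_polyC_leq1 _)).
Qed.

Lemma size_slice_y f s : (size (slice_y f s) <= msize f)%N.
Proof.
apply: size_mslice => i; case: ifP => _; last by rewrite size_polyX.
by rewrite (leq_trans (size_scale_leq _ _))// -opprB size_polyN size_XsubC.
Qed.

(* A version of Dy whose measurability needs no division: powR_inv1 identifies
   the two on the trapezoid, where 2 - y >= 1. *)
Let Dy' f z : R := dy f z - z.1 * (2 - z.2) `^ (-1) * dx f z.

Let N_Dy f : N (fun z => Phiy z * Dy f z) = N (fun z => Phiy z * Dy' f z).
Proof.
apply: eq_normsq => -[x y]; rewrite /trapezoid/= => -[/andP[y0 y1] _].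
by rewrite /Dy /Dy' powR_inv1//= subr_ge0; lra.
Qed.

Let m_eval f : measurable_fun setT (Kpull (eval2 f)).
Proof. by apply: measurable_Kpull; exact: measurable_eval2. Qed.

Let m_x f : measurable_fun setT (fun z => Phix z * dx f z).
Proof.
apply: measurable_funM; last exact: measurable_eval2.
apply: measurable_sqrt_comp; apply: measurable_funM => //.
by do 2?apply: measurable_funB.
Qed.

Let m_y f : measurable_fun setT (fun z => Phiy z * Dy' f z).
Proof.
apply: measurable_funM.
  apply: measurable_sqrt_comp; apply: measurable_funM => //.
  exact: measurable_funB.
apply: measurable_funB; first exact: measurable_eval2.
apply: measurable_funM; last exact: measurable_eval2.
apply: measurable_funM => //.
by apply: (measurableT_comp (measurable_powR _)); exact: measurable_funB.
Qed.

Let m_swap u : measurable_fun setT (Kpull u) ->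
  measurable_fun setT (fun z => Kpull u (z.2, z.1)).
Proof.
move=> mu_; apply: (measurableT_comp mu_).
exact: measurable_fun_pair.
Qed.

Lemma normsqE u : measurable_fun setT u ->
  (N u = \int[mu]_(y in `[0%R, 1%R]) \int[mu]_(s in `[0%R, 1%R]) Kpull u (s, y))%E.
Proof. exact: normsq_pullback. Qed.

Lemma normsqE_swap u : measurable_fun setT u ->
  (N u = \int[mu]_(s in `[0%R, 1%R]) \int[mu]_(y in `[0%R, 1%R]) Kpull u (s, y))%E.
Proof.
move=> mu_; rewrite (normsqE mu_).
exact: (integral_unit_square_swap (measurable_Kpull mu_) (Kpull_ge0 u)).
Qed.

Lemma fiber_x f y :
  (\int[mu]_(s in `[0%R, 1%R]) Kpull (eval2 f) (s, y) =
   (jint gamma delta (slice_x f y ^+ 2) * wJ alpha beta y)%:E)%E.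
Proof.
apply: integral_fiber => // s _.
by rewrite /Kpull/= horner_exp horner_slice_x mulrA.
Qed.

Lemma fiber_y f s :
  (\int[mu]_(y in `[0%R, 1%R]) Kpull (eval2 f) (s, y) =
   (jint alpha beta (slice_y f s ^+ 2) * wJ gamma delta s)%:E)%E.
Proof.
apply: integral_fiber => // y _.
by rewrite /Kpull/= horner_exp horner_slice_y [wJ gamma _ _ * _]mulrC mulrA.
Qed.

(** After substitution Phi_x^2 = (2-y)^2 s(1-s), and the factor (2-y)^2 is the square of the
    chain-rule factor in [deriv_slice_x]. *)
Lemma fiber_dx f y : 0 <= y <= 1 ->
  (\int[mu]_(s in `[0%R, 1%R]) Kpull (fun z => Phix z * dx f z)%R (s, y) =
   (dirichlet gamma delta (slice_x f y) (slice_x f y) * wJ alpha beta y)%:E)%E.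
Proof.
move=> /andP[y0 y1]; apply: integral_fiber => // s /andP[s0 s1].
rewrite /Kpull/= !hornerM deriv_slice_x mulrA exprMn /Phix/= sqr_sqrtr; last first.
  rewrite (_ : _ * _ = (2 - y) ^+ 2 * (s * (1 - s))); last by ring.
  by rewrite mulr_ge0 ?sqr_ge0// mulr_ge0// subr_ge0.
congr (_ * _ * _)%:E; rewrite !hornerE/=; ring.
Qed.

Lemma fiber_Dy f s : 0 <= s <= 1 ->
  (\int[mu]_(y in `[0%R, 1%R]) Kpull (fun z => Phiy z * Dy' f z)%R (s, y) =
   (dirichlet alpha beta (slice_y f s) (slice_y f s) * wJ gamma delta s)%:E)%E.
Proof.
move=> /andP[s0 s1]; apply: integral_fiber => // y /andP[y0 y1].
have y2 : y != 2 by rewrite lt_eqF//; lra.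
rewrite /Kpull/= !hornerM deriv_slice_y// exprMn /Phiy/= sqr_sqrtr; last first.
  by rewrite mulr_ge0// subr_ge0.
have -> : Dy' f ((2 - y) * s, y) = Dy f ((2 - y) * s, y).
  by rewrite /Dy /Dy' powR_inv1//= subr_ge0; lra.
by congr _%:E; rewrite !hornerE/=; ring.
Qed.

Lemma bernstein_x f n : (msize f <= n.+1)%N ->
  (N (fun z => Phix z * dx f z)%R <= (eigen gamma delta n)%:E * N (eval2 f))%E.
Proof.
move=> sf; rewrite (normsqE (m_x f)) (normsqE (@measurable_eval2 f)).
apply: (le_integral_fibers (measurable_Kpull (m_x f)) (Kpull_ge0 _) (m_eval f)
  (Kpull_ge0 _)) => [|y]; first exact: eigen_ge0.
rewrite /= in_itv/= => y01; rewrite fiber_dx// fiber_x -EFinM lee_fin [leRHS]mulrA.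
rewrite ler_wpM2r ?wJ_ge0// jacobi_bernstein//.
exact: leq_trans (size_slice_x f y) sf.
Qed.

Lemma bernstein_y f n : (msize f <= n.+1)%N ->
  (N (fun z => Phiy z * Dy f z)%R <= (eigen alpha beta n)%:E * N (eval2 f))%E.
Proof.
move=> sf; rewrite N_Dy (normsqE_swap (m_y f)) (normsqE_swap (@measurable_eval2 f)).
(* The coordinates are swapped because the fibers now run in y, while [le_integral_fibers]
   integrates the first coordinate innermost. *)
apply: (@le_integral_fibers _ (fun z => Kpull (fun z => Phiy z * Dy' f z)%R (z.2, z.1))
  (fun z => Kpull (eval2 f) (z.2, z.1))).
- exact: (m_swap (measurable_Kpull (m_y f))).
- by move=> z; exact: Kpull_ge0.
- exact: (m_swap (m_eval f)).
- by move=> z; exact: Kpull_ge0.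
- exact: eigen_ge0.
move=> s; rewrite /= in_itv/= => s01.
rewrite fiber_Dy// fiber_y -EFinM lee_fin [leRHS]mulrA.
rewrite ler_wpM2r ?wJ_ge0// jacobi_bernstein//.
exact: leq_trans (size_slice_y f s) sf.
Qed.

(** * Equality for polynomials that split as a product in the coordinates (s, y) *)

Definition separated f P Q := forall s y, 0 <= s <= 1 -> 0 <= y <= 1 ->
  eval2 f ((2 - y) * s, y) = P.[s] * Q.[y].

(** A nonzero difference would have a square of positive integral, by [jint_sqr_gt0] for the
    constant weight a = b = 0. *)
Lemma poly_eq_itv p q : {in `[(0 : R), 1], forall x, p.[x] = q.[x]} -> p = q.
Proof.
move=> pq; apply/eqP; rewrite -subr_eq0; apply: contraT.
have m1 : -1 < 0 :> R by rewrite oppr_lt0.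
move=> /(jint_sqr_gt0 m1 m1); rewrite -lte_fin EFin_jint//.
rewrite (_ : integral _ _ _ = 0%E) ?ltxx//; apply: integral0_eq => x x01.
by rewrite horner_exp hornerD hornerN pq// subrr expr0n mul0r.
Qed.

Section Separated.
Variables (f : mpoly 2 R) (P Q : {poly R}).
Hypothesis fPQ : separated f P Q.

Lemma slice_x_separated y : 0 <= y <= 1 -> slice_x f y = Q.[y] *: P.
Proof.
move=> y01; apply: poly_eq_itv => s; rewrite in_itv/= => s01.
by rewrite horner_slice_x fPQ// hornerZ mulrC.
Qed.

Lemma slice_y_separated s : 0 <= s <= 1 -> slice_y f s = P.[s] *: Q.
Proof.
move=> s01; apply: poly_eq_itv => y; rewrite in_itv/= => y01.
by rewrite horner_slice_y fPQ// hornerZ.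
Qed.

Lemma normsq_separated :
  N (eval2 f) = (jint gamma delta (P ^+ 2) * jint alpha beta (Q ^+ 2))%:E.
Proof.
rewrite (normsqE (@measurable_eval2 f)) mulrC.
apply: (@integral_fiber alpha beta) => // y y01.
rewrite fiber_x slice_x_separated// exprZn jintZ// horner_exp.
by congr _%:E; ring.
Qed.

Lemma bernstein_x_eq n c : P = c *: sjacobi n gamma delta ->
  N (fun z => Phix z * dx f z) = ((eigen gamma delta n)%:E * N (eval2 f))%E.
Proof.
move=> Pc; rewrite (normsqE (m_x f)) (normsqE (@measurable_eval2 f)).
apply: (eq_integral_fibers (m_eval f) (Kpull_ge0 _)) => [|y]; first exact: eigen_ge0.
rewrite /= in_itv/= => y01; rewrite fiber_dx// fiber_x -EFinM [in RHS]mulrA.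
by rewrite slice_x_separated// Pc scalerA dirichlet_scale_sjacobi.
Qed.

Lemma bernstein_y_eq n c : Q = c *: sjacobi n alpha beta ->
  N (fun z => Phiy z * Dy f z) = ((eigen alpha beta n)%:E * N (eval2 f))%E.
Proof.
move=> Qc; rewrite N_Dy (normsqE_swap (m_y f)) (normsqE_swap (@measurable_eval2 f)).
apply: (@eq_integral_fibers _ (fun z => Kpull (fun z => Phiy z * Dy' f z)%R (z.2, z.1))
  (fun z => Kpull (eval2 f) (z.2, z.1))).
- exact: (m_swap (m_eval f)).
- by move=> z; exact: Kpull_ge0.
- exact: eigen_ge0.
move=> s; rewrite /= in_itv/= => s01; rewrite fiber_Dy// fiber_y -EFinM [in RHS]mulrA.
by rewrite slice_y_separated// Qc scalerA dirichlet_scale_sjacobi.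
Qed.

End Separated.

(** In the coordinates (s, y) the argument x/(2-y) is just s, and the power (2-y)^k joins the factor
    in y. *)
Lemma bbP_separated (F : nat -> nat -> {poly R}) n k :
  separated (bbP gamma delta F n k) (sjacobi k gamma delta)
    ((2%:P - 'X) ^+ k * F (n - k)%N k).
Proof.
move=> s y _ /andP[y0 y1]; have y2 : y != 2 by rewrite lt_eqF//; lra.
have c0 : 2 - y != 0 by rewrite subr_eq0 eq_sym.
rewrite bbPE// [_ * s / _]mulrAC mulfV// mul1r !hornerE/=; ring.
Qed.

Lemma msizeM_leD (p q : mpoly 2 R) i j :
  (msize p <= i.+1)%N -> (msize q <= j.+1)%N -> (msize (p * q) <= (i + j).+1)%N.
Proof.
have [->|p0] := eqVneq p 0; first by rewrite mul0r msize0.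
have [->|q0] := eqVneq q 0; first by rewrite mulr0 msize0.
move=> pi qj; rewrite msizeM// -subn1 leq_subLR add1n.
by apply: leq_trans (leq_add pi qj) _; rewrite addSn addnS.
Qed.

Lemma msize_expr_le (q : mpoly 2 R) k : (msize q <= 2)%N -> (msize (q ^+ k) <= k.+1)%N.
Proof.
move=> sq; elim: k => [|k IH]; first by rewrite expr0 msize1.
by rewrite exprS; exact: (@msizeM_leD _ _ 1 k).
Qed.

Lemma bbP_Pi (F : nat -> nat -> {poly R}) n k : (k <= n)%N ->
  (size (F (n - k)%N k) <= (n - k).+1)%N -> Pi_n n (bbP gamma delta F n k).
Proof.
move=> kn sF; rewrite /Pi_n /= /bbP -(subnKC kn).
have sX i : (msize (mpolyX R (mnm1 i) : mpoly 2 R) <= 2)%N by rewrite msizeX mdeg1.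
have s2Y : (msize (2 - mY R) <= 2)%N.
  apply: leq_trans (msizeD_le _ _) _; rewrite geq_max msizeN sX andbT.
  by rewrite -mpolyC_nat msizeC; case: (_ != 0).
apply: msizeM_leD.
  rewrite /homog; apply: leq_trans (msize_sum _ _ _) _.
  apply/bigmax_leqP_seq => i _ _; apply: leq_trans (msizeZ_le _ _) _.
  have ik : (i <= k)%N by rewrite -ltnS.
  (* Each term of [homog] has degree i + (k - i) = k. *)
  rewrite -[X in (_ <= X.+1)%N](subnKC ik).
  by apply: msizeM_leD; [exact: (msize_expr_le _ (sX iX)) | exact: msize_expr_le].
rewrite subnKC// /map_poly horner_poly; apply: leq_trans (msize_sum _ _ _) _.
apply/bigmax_leqP_seq => i _ _; rewrite mul_mpolyC.
apply: leq_trans (msizeZ_le _ _) _; apply: leq_trans (msize_expr_le _ (sX iY)) _.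
exact: leq_trans (ltn_ord i) sF.
Qed.

End Trapezoid.

(** Cancelling the norm requires it to be finite and positive; for a separated polynomial it is a
    product of two positive reals. *)
Lemma le_of_normsq_separated (R : realType) (alpha beta gamma delta c C : R)
    (f : mpoly 2 R) (P Q : {poly R}) :
  -1 < alpha -> -1 < beta -> -1 < gamma -> -1 < delta ->
  separated f P Q -> P != 0 -> Q != 0 ->
  (c%:E * normsq alpha beta gamma delta (eval2 f) <=
   C%:E * normsq alpha beta gamma delta (eval2 f))%E -> c <= C.
Proof.
move=> al1 be1 ga1 de1 fPQ P0 Q0.
rewrite (normsq_separated al1 be1 ga1 de1 fPQ) -!EFinM lee_fin ler_pM2r//.
by rewrite mulr_gt0// jint_sqr_gt0.
Qed.

Theorem proposition5p1 (R : realType) (alpha beta gamma delta : R) (n : nat)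
    (halpha : -1 < alpha) (hbeta : -1 < beta)
    (hgamma : -1 < gamma) (hdelta : -1 < delta) (hn : (1 <= n)%N) :
  let N := normsq alpha beta gamma delta in
  let cx : R := n%:R * (n%:R + gamma + delta + 1) in
  let cy : R := n%:R * (n%:R + alpha + beta + 1) in
  (* the two inequalities *)
  (forall f : mpoly 2 R, Pi_n n f ->
     (N (fun z => (Phix z * dx f z)%R) <= cx%:E * N (eval2 f))%E /\
     (N (fun z => (Phiy z * Dy f z)%R) <= cy%:E * N (eval2 f))%E) /\
  (* sharpness of the constants *)
  (forall C : R,
     (forall f : mpoly 2 R, Pi_n n f ->
        (N (fun z => (Phix z * dx f z)%R) <= C%:E * N (eval2 f))%E) -> cx <= C) /\
  (forall C : R,
     (forall f : mpoly 2 R, Pi_n n f ->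
        (N (fun z => (Phiy z * Dy f z)%R) <= C%:E * N (eval2 f))%E) -> cy <= C) /\
  (* extremal polynomials *)
  (forall P : nat -> nat -> {poly R}, orthonormal_family alpha beta P ->
     let fx := bbP gamma delta P n n in
     let fy := bbP gamma delta P n 0 in
     (Pi_n n fx /\ N (fun z => (Phix z * dx fx z)%R) = (cx%:E * N (eval2 fx))%E) /\
     (Pi_n n fy /\ N (fun z => (Phiy z * Dy fy z)%R) = (cy%:E * N (eval2 fy))%E)).
Proof.
move=> N cx cy.
have sepP F k : separated (bbP gamma delta F n k) (sjacobi k gamma delta)
    ((2%:P - 'X) ^+ k * F (n - k)%N k) by exact: bbP_separated.
have sj0 k (a b : R) (a1 : -1 < a) (b1 : -1 < b) : sjacobi k a b != 0.
  by rewrite -size_poly_gt0 size_sjacobi.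
(* For k = n the factor in s is the Jacobi polynomial of degree n whatever F is. Only the degree of
   [F 0 n] matters, so this serves both sharpness and the extremal claim. *)
have extx (F : nat -> nat -> {poly R}) : size (F 0 n) = 1%N ->
    Pi_n n (bbP gamma delta F n n) /\
    N (fun z => (Phix z * dx (bbP gamma delta F n n) z)%R) =
    (cx%:E * N (eval2 (bbP gamma delta F n n)))%E.
  move=> sF; split; first by apply: bbP_Pi; rewrite ?subnn// sF.
  by apply: (bernstein_x_eq _ _ _ _ (sepP F n) (c := 1)); rewrite ?scale1r.
have exty (F : nat -> nat -> {poly R}) c :
    size (F n 0) = n.+1 -> F n 0 = c *: sjacobi n alpha beta ->
    Pi_n n (bbP gamma delta F n 0) /\
    N (fun z => (Phiy z * Dy (bbP gamma delta F n 0) z)%R) =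
    (cy%:E * N (eval2 (bbP gamma delta F n 0)))%E.
  move=> sF Fc; split; first by apply: bbP_Pi; rewrite ?subn0// sF.
  by apply: (bernstein_y_eq _ _ _ _ (sepP F 0) (c := c)); rewrite // expr0 mul1r subn0.
split; [|split; [|split]].
- by move=> f fn; split; [exact: bernstein_x | exact: bernstein_y].
(* No orthonormal family is given here; the constant family 1 provides the witness, with (2-y)^n as
   its factor in y. *)
- move=> C HC; pose F := fun _ _ : nat => 1 : {poly R}.
  have [Pi e] := extx F (size_poly1 _).
  apply: (le_of_normsq_separated halpha hbeta hgamma hdelta (sepP F n)).
  + exact: sj0.
  + rewrite /F mulr1 expf_neq0// -opprB oppr_eq0.
    exact/monic_neq0/monicXsubC.
  + by rewrite -[leLHS]e; exact: HC.
(* Here the shifted Jacobi polynomials themselves, without normalization, provide the witness. *)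
- move=> C HC; pose F := fun m _ : nat => sjacobi m alpha beta.
  have [||Pi e] := exty F 1; rewrite ?scale1r//; first exact: size_sjacobi.
  apply: (le_of_normsq_separated halpha hbeta hgamma hdelta (sepP F 0)).
  + exact: sj0.
  + by rewrite expr0 mul1r; exact: sj0.
  + by rewrite -[leLHS]e; exact: HC.
- move=> P [sP oP] fx fy; split; first by apply: extx; rewrite sP.
  (* At k = 0 the weight (2-y)^(2k) is 1, so the family is orthogonal for the pure Jacobi weight and
     uniqueness applies. *)
  have [c Pc] : exists c, P n 0 = c *: sjacobi n alpha beta.
    apply: (@orth_sjacobi _ _ _ halpha hbeta (P ^~ 0)) => // m l ml.
    apply: EFin_inj; rewrite EFin_jint//; have := oP 0 m l; rewrite (negPf ml) => <-.
    by apply: eq_integral => y _; rewrite hornerM /wJ muln0 expr0 mul1r.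
  by apply: exty Pc; rewrite sP.
Qed.
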